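(* Let $m\ge 1$ be an integer with $\gcd(3,m)=1$, let $\Bbbk$ be a field, and let $T=\Bbbk[x_1,x_2,x_3]$ be graded by the weights $\operatorname{wt}(x_1)=3$, $\operatorname{wt}(x_2)=3+m$, $\operatorname{wt}(x_3)=3+2m$. Let $\mathfrak p\subset T$ be the defining ideal of the monomial curve parametrized by $(t^{3},t^{3+m},t^{3+2m})$. Then $$1\le\frac{\alpha(\mathfrak p)}{\gamma(\mathfrak p)}\le\rho(\mathfrak p).$$
   Context: $\mathfrak p$ is the kernel of the $\Bbbk$-algebra map $T\to\Bbbk[t]$, $x_1\mapsto t^3$, $x_2\mapsto t^{3+m}$, $x_3\mapsto t^{3+2m}$; it and its symbolic powers $\mathfrak p^{(n)}=\mathfrak p^nT_{\mathfrak p}\cap T$ are homogeneous for the weighted grading. For a nonzero weighted homogeneous ideal $I$, $\alpha(I)=\min\{n: I_n\ne 0\}$ is the least weighted degree of a nonzero homogeneous element of $I$; the Waldschmidt constant is $\gamma(I)=\lim_{n\to\infty}\alpha(I^{(n)})/n$; the resurgence is $\rho(I)=\sup\{\,n/r : n,r\ge 1,\ I^{(n)}\not\subseteq I^r\,\}$. *)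

(* Defs.v *)
From HB Require Import structures.
From mathcomp Require Import all_boot all_order all_algebra.
From mathcomp Require Import mpoly.
From mathcomp Require Import boolp classical_sets reals ereal topology.
From mathcomp Require Import normedtype sequences.

Set Implicit Arguments.
Unset Strict Implicit.
Unset Printing Implicit Defensive.

Import Order.TTheory GRing.Theory Num.Theory.
Import numFieldNormedType.Exports.

Local Open Scope classical_set_scope.
Local Open Scope ring_scope.

Section Ideals.
Variable A : idomainType.

(* Finite sums of c_i * x_i with c_i in S and x_i in X: the ideal generated by
   X when S is the whole ring, and the S-submodule generated by X when S is a
   subring. *)
Definition lin_span (B : comNzRingType) (S X : set B) : set B :=
  [set y | exists (r : nat) (c x : 'I_r -> B),
    [/\ forall i, S (c i), forall i, X (x i) & y = \sum_(i < r) c i * x i]].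

Definition ideal_pow (I : set A) (n : nat) : set A :=
  lin_span setT
    [set \prod_(i < n) f i | f in [set f : 'I_n -> A | forall i, I (f i)]].

(* For a prime ideal P, the local ring A_P, as a subring of Frac A. *)
Definition localization (P : set A) : set {fraction A} :=
  [set FracField.tofrac a / FracField.tofrac s | a in setT & s in ~` P].

Definition extension (P I : set A) : set {fraction A} :=
  lin_span (localization P) [set FracField.tofrac a | a in I].

Definition contracted (J : set {fraction A}) : set A :=
  [set a | J (FracField.tofrac a)].

Definition symb_pow (P : set A) (n : nat) : set A :=
  contracted (extension P (ideal_pow P n)).

Definition resurgence (R : realType) (P : set A) : \bar R :=
  ereal_sup [set q | exists n r : nat,
    [/\ (1 <= n)%N, (1 <= r)%N, ~ (symb_pow P n `<=` ideal_pow P r)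
      & q = (n%:R / r%:R)%:E]].

End Ideals.

Section Weights.
Variables (k : fieldType) (n : nat) (w : 'I_n -> nat).

Definition wdeg (mon : 'X_{1..n}) : nat := (\sum_(i < n) mon i * w i)%N.

Fact wdeg0 : wdeg 0%MM = 0%N.
Proof. by rewrite /wdeg big1 // => i _; rewrite mnm0E. Qed.

Fact wdegD : {morph wdeg : m1 m2 / (m1 + m2)%MM >-> (m1 + m2)%N}.
Proof.
move=> m1 m2; rewrite /wdeg -big_split /=.
by apply: eq_bigr => i _; rewrite mnmDE mulnDl.
Qed.

HB.instance Definition _ := isMeasure.Build n wdeg wdeg0 wdegD.

(* The graded piece I_d is nonzero. *)
Definition has_form (I : set {mpoly k[n]}) (d : nat) : Prop :=
  exists f : {mpoly k[n]}, [/\ I f, f != 0 & f \is d.-homog for wdeg].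

(* The value 0 is a default for ideals without nonzero homogeneous element. *)
Definition alpha (I : set {mpoly k[n]}) : nat :=
  if pselect (exists d, `[< has_form I d >]) is left e then ex_minn e else 0%N.

Definition waldschmidt (R : realType) (P : set {mpoly k[n]}) : R :=
  lim ((fun j : nat => (alpha (symb_pow P j))%:R / j%:R : R) @ \oo).

End Weights.

Section MonomialCurve.
Variables (k : fieldType) (m : nat).

(* 3, 3 + m, 3 + 2m *)
Definition wt (i : 'I_3) : nat := (3 + i * m)%N.

Definition curve_map : {mpoly k[3]} -> {poly k} :=
  mmap polyC (fun i : 'I_3 => 'X^(wt i)).

Definition curve_ideal : set {mpoly k[3]} := [set f | curve_map f = 0].

End MonomialCurve.
Arguments curve_map k m : clear implicits.
Arguments curve_ideal k m : clear implicits.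

(* Main.v *)
Require Import Defs.
From HB Require Import structures.
From mathcomp Require Import all_boot all_order all_algebra.
From mathcomp Require Import mpoly.
From mathcomp Require Import boolp classical_sets reals ereal topology.
From mathcomp Require Import normedtype sequences.
From mathcomp Require Import lra.

(* An inclusion [P^(n) <= P^r] of a symbolic power in an ordinary one forces
   [r * alpha P <= alpha (P^(n))], since [P] is homogeneous.  So if [r] is the
   least integer with [alpha (P^(n)) < r * alpha P], then [n / r] bounds the
   resurgence from below, and it is at least
   [alpha P / (alpha (P^(n)) / n + alpha P / n)], which tends to
   [alpha P / gamma P].  The limit [gamma P] exists by Fekete's lemma and is at
   most [alpha P].  It is at least 1 because a nonzero element of [P^(n)]
   vanishes to order [n] at the generic point of the curve, so has degree at
   least [n]. *)

Set Implicit Arguments.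
Unset Strict Implicit.
Unset Printing Implicit Defensive.

Import Order.TTheory GRing.Theory Num.Theory.
Import numFieldNormedType.Exports.

Local Open Scope classical_set_scope.
Local Open Scope ring_scope.

(** * Ordinary and symbolic powers of an ideal in a domain *)

Section IdealPowers.
Variable A : idomainType.
Implicit Types (X I P : set A) (n : nat).

Lemma lin_span_incl X x : X x -> lin_span setT X x.
Proof.
by move=> Xx; exists 1, (fun=> 1), (fun=> x); rewrite big_ord1 mul1r.
Qed.

Lemma lin_spanD X : {in lin_span setT X &, forall x y, lin_span setT X (x + y)}.
Proof.
move=> _ _ /set_mem[r1 [c1 [x1 [_ X1 ->]]]] /set_mem[r2 [c2 [x2 [_ X2 ->]]]].
exists (r1 + r2),
  (fun i => match split i with inl j => c1 j | inr j => c2 j end),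
  (fun i => match split i with inl j => x1 j | inr j => x2 j end).
split=> // [i|]; first by case: split.
by rewrite big_split_ord; congr (_ + _); apply: eq_bigr => i _;
   rewrite ?(unsplitK (inl i)) ?(unsplitK (inr i)).
Qed.

Lemma lin_spanZ X a x : lin_span setT X x -> lin_span setT X (a * x).
Proof.
move=> [r [c [y [_ Xy ->]]]]; exists r, (fun i => a * c i), y; split=> //.
by rewrite mulr_sumr; apply: eq_bigr => i _; rewrite mulrA.
Qed.

Lemma lin_span0 X : lin_span setT X 0.
Proof.
exists 0, (fun=> 0), (fun=> 0); rewrite big_ord0; split=> //.
by case.
Qed.

Lemma lin_span_sum X (J : Type) (s : seq J) (F : J -> A) :
  (forall j, lin_span setT X (F j)) -> lin_span setT X (\sum_(j <- s) F j).
Proof.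
move=> XF; apply: (big_ind (lin_span setT X)) => //; first exact: lin_span0.
by move=> x y Xx Xy; apply: lin_spanD; apply: mem_set.
Qed.

Lemma lin_spanM X Y Z :
  (forall x y, X x -> Y y -> Z (x * y)) ->
  forall x y, lin_span setT X x -> lin_span setT Y y -> lin_span setT Z (x * y).
Proof.
move=> XYZ _ _ [r [c [x [_ Xx ->]]]] [s [d [y [_ Yy ->]]]].
rewrite mulr_suml; apply: lin_span_sum => i.
rewrite mulr_sumr; apply: lin_span_sum => j.
by rewrite mulrACA; apply/lin_spanZ/lin_span_incl/XYZ.
Qed.

Lemma ideal_powM I n1 n2 x y :
  ideal_pow I n1 x -> ideal_pow I n2 y -> ideal_pow I (n1 + n2) (x * y).
Proof.
apply: lin_spanM => _ _ [f1 /= If1 <-] [f2 /= If2 <-].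
exists (fun i => match split i with inl j => f1 j | inr j => f2 j end) => /=.
  by move=> i; case: split.
by rewrite big_split_ord; congr (_ * _); apply: eq_bigr => i _;
   rewrite ?(unsplitK (inl i)) ?(unsplitK (inr i)).
Qed.

Lemma ideal_powX I n x : I x -> ideal_pow I n (x ^+ n).
Proof.
move=> Ix; apply: lin_span_incl; exists (fun=> x) => //.
by rewrite prodr_const card_ord.
Qed.

(** [K] behaves like a multiplicative filtration with [I] in step 1. It will be the filtration by
    weighted degree, then the one by order of vanishing along the curve. *)
Lemma ideal_pow_ind I (K : nat -> set A) :
  (forall n, K n 0) -> (forall n x y, K n x -> K n y -> K n (x + y)) ->
  (forall n1 n2 x y, K n1 x -> K n2 y -> K (n1 + n2) (x * y)) ->
  (forall a, K 0 a) -> (forall x, I x -> K 1 x) ->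
  forall n, ideal_pow I n `<=` K n.
Proof.
move=> K0 KD KM KT KI n _ [r [c [x [_ Xx ->]]]].
apply: big_ind => // [y z|i _]; first exact: KD.
have [f /= If <-] := Xx i; apply: (KM 0) => //.
elim: n f If {Xx} => [|n IHn] f If; first exact: KT.
rewrite big_ord_recl; apply: (KM 1); first exact/KI/If.
by apply: IHn => j; apply: If.
Qed.

Section Prime.
Variable P : set A.
Hypotheses (P0 : P 0) (P1 : ~ P 1).
Hypothesis PM : forall x y, ~ P x -> ~ P y -> ~ P (x * y).

(** Multiplying a sum of fractions by the product of its denominators clears them, and primality
    keeps that product outside [P]. *)
Lemma symb_powP n x :
  symb_pow P n x <-> exists2 s, ~ P s & ideal_pow P n (s * x).
Proof.
have nz s : ~ P s -> FracField.tofrac s != 0.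
  by move=> Ps; rewrite tofrac_eq0; apply/eqP => s0; rewrite s0 in Ps.
have clear_den (F : fieldType) (u v d e : F) :
    u != 0 -> u * v * (d / u * e) = v * d * e.
  move=> u0; rewrite !mulrA; congr (_ * _).
  by rewrite mulrAC [_ / u]mulrAC divff ?mul1r.
split=> [[r [c [y [cP yI xE]]]]|[s Ps sxP]]; last first.
  exists 1, (fun=> FracField.tofrac 1 / FracField.tofrac s),
    (fun=> FracField.tofrac (s * x)); split=> [_|_|].
  - by exists 1 => //; exists s.
  - by exists (s * x).
  - by rewrite big_ord1 rmorph1 mul1r rmorphM mulKf ?nz.
have /choice[a /choice[s aE]] i :
    exists a s, ~ P s /\ c i = FracField.tofrac a / FracField.tofrac s.
  by have [a _ [s Ps <-]] := cP i; exists a, s.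
have /choice[b bE] i : exists b, ideal_pow P n b /\ y i = FracField.tofrac b.
  by have [b Ib <-] := yI i; exists b.
exists (\prod_i s i).
  by apply: (big_ind (fun s => ~ P s)) => // i _; case: (aE i).
suff -> : (\prod_i s i) * x = \sum_i (\prod_(j | j != i) s j) * a i * b i.
  by apply: lin_span_sum => i; apply: lin_spanZ; case: (bE i).
apply/eqP; rewrite -tofrac_eq rmorphM [X in _ * X]xE mulr_sumr raddf_sum.
apply/eqP/eq_bigr => i _; rewrite (bigD1 i) //=.
have [[Ps ->] [_ ->]] := (aE i, bE i).
by rewrite !tofracM clear_den ?nz.
Qed.

Lemma symb_powM n1 n2 x y :
  symb_pow P n1 x -> symb_pow P n2 y -> symb_pow P (n1 + n2) (x * y).
Proof.
move=> /symb_powP[s Ps sx] /symb_powP[t Pt ty]; apply/symb_powP.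
by exists (s * t); [exact: PM|rewrite mulrACA; exact: ideal_powM].
Qed.

Lemma ideal_pow_symb n : ideal_pow P n `<=` symb_pow P n.
Proof. by move=> x Px; apply/symb_powP; exists 1; rewrite ?mul1r. Qed.

End Prime.
End IdealPowers.

(* Fekete's lemma: [u j / j] converges to its infimum. *)
Lemma subadditive_cvg (R : realType) (u : nat -> nat) :
  (forall a b, u (a + b) <= u a + u b)%N ->
  cvg ((fun j => (u j)%:R / j%:R : R) @ \oo).
Proof.
move=> u_sub; pose v j : R := (u j)%:R / j%:R.
have v_ge0 j : 0 <= v j by apply: divr_ge0.
(* [v 0] is 0 by the convention on division by zero, so index 0 must stay out of the infimum. *)
pose E := [set v j | j in [set j | 0 < j]%N].
have E_lb : has_lbound E by exists 0 => _ [j _ <-].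
have E_inf : has_inf E by split=> //; exists (v 1%N), 1%N.
apply/cvg_ex; exists (inf E); apply/cvgrPdist_le => e e0.
have [_ [N /= N0 <-] vN] := inf_adherent (divr_gt0 e0 (ltr0n _ 2)) E_inf.
(* Bounds the contribution of every remainder modulo [N] in [u_div]; [u 0] may be nonzero. *)
pose C := (N * u 1 + u 0)%N.
have u_div q r : (u (q * N + r) <= q * u N + (r * u 1 + u 0))%N.
  elim: q => [|q IHq].
    rewrite !mul0n !add0n; elim: r => [|r IHr]; first by rewrite mul0n.
    by rewrite -add1n mulnDl mul1n -addnA (leq_trans (u_sub _ _))// leq_add2l.
  by rewrite !mulSn -!addnA (leq_trans (u_sub _ _))// leq_add2l.
near=> j.
have j0 : (0 < j)%N by near: j; exact: nbhs_infty_ge.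
have j0R : 0 < j%:R :> R by rewrite ltr0n.
have inf_le : inf E <= v j by apply: ge_inf => //; exists j.
have Cj : C%:R <= e / 2 * j%:R.
  rewrite mulrC -ler_pdivrMr; last lra.
  by near: j; exact: nbhs_infty_ger.
rewrite -/(v j) distrC ger0_norm ?subr_ge0 // lerBlDl.
suff : v j <= v N + e / 2 by lra.
rewrite ler_pdivrMr // mulrDl.
apply: le_trans (_ : (j %/ N * u N)%:R + C%:R <= _).
  rewrite -natrD ler_nat {1}(divn_eq j N) (leq_trans (u_div _ _))// leq_add2l.
  by rewrite leq_add2r leq_mul2r ltnW ?orbT // ltn_mod.
apply: lerD => //; rewrite /v mulrAC ler_pdivlMr ?ltr0n // -!natrM ler_nat.
by rewrite mulnAC [(u N * j)%N]mulnC leq_mul2r leq_trunc_div orbT.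
Unshelve. all: by end_near.
Qed.

(** * Least weighted degrees and ideal powers *)

Section Alpha.
Variables (k : fieldType) (n : nat) (w : 'I_n -> nat).
Implicit Types (I : set {mpoly k[n]}) (d : nat).

Lemma has_form_alpha I d : has_form w I d -> has_form w I (alpha w I).
Proof.
move=> Id; rewrite /alpha; case: pselect => [e|[]]; last first.
  by exists d; apply/asboolP.
by case: ex_minnP => j /asboolP.
Qed.

Lemma alpha_le I d : has_form w I d -> (alpha w I <= d)%N.
Proof.
move=> Id; rewrite /alpha; case: pselect => [e|[]]; last first.
  by exists d; apply/asboolP.
by case: ex_minnP => j _; apply; apply/asboolP.
Qed.

Lemma has_formM I1 I2 I3 d1 d2 :
  (forall f g, I1 f -> I2 g -> I3 (f * g)) ->
  has_form w I1 d1 -> has_form w I2 d2 -> has_form w I3 (d1 + d2).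
Proof.
move=> I12 [f [If f0 fd]] [g [Ig g0 gd]]; exists (f * g); split.
- exact: I12.
- exact: mulf_neq0.
- exact: dhomogM.
Qed.

(** Implied by containing the homogeneous components of [f]; only the degrees that occur matter for
    comparing values of [alpha]. *)
Definition homogeneous I :=
  forall f m, I f -> m \in msupp f -> has_form w I (wdeg w m).

(** By homogeneity, [alpha w I] bounds from below the degree of each monomial in an element of [I],
    and such bounds add up in products. *)
Lemma ideal_pow_wdeg I r f m : homogeneous I ->
  ideal_pow I r f -> m \in msupp f -> (r * alpha w I <= wdeg w m)%N.
Proof.
move=> homI.
pose K r := [set f : {mpoly k[n]} |
  forall m, m \in msupp f -> (r * alpha w I <= wdeg w m)%N].
move=> If; move: m; rewrite -/(K r f); move: f If; rewrite -/(subset _ _).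
apply: (@ideal_pow_ind _ I K) => //= {r}.
- by move=> r m; rewrite msupp0.
- by move=> r f g Kf Kg m /msuppD_le; rewrite mem_cat => /orP[/Kf|/Kg].
- move=> r1 r2 f g Kf Kg m.
  move=> /msuppM_le/allpairsP[[m1 m2] /= [/Kf m1f /Kg m2g ->]].
  by rewrite wdegD mulnDl leq_add.
- by move=> f If m fm; rewrite mul1n; apply/alpha_le/(homI f).
Qed.

Lemma alpha_ideal_pow I r d : homogeneous I ->
  has_form w (ideal_pow I r) d -> (r * alpha w I <= d)%N.
Proof.
move=> homI [f [If f0 /dhomogP fd]].
by rewrite -(fd _ (mlead_supp f0)) (ideal_pow_wdeg homI If) ?mlead_supp.
Qed.

End Alpha.

(** * Waldschmidt constant and resurgence of a homogeneous prime *)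

Section Waldschmidt.
Variables (k : fieldType) (n : nat) (w : 'I_n -> nat) (R : realType).
Variables (P : set {mpoly k[n]}) (d0 : nat).
Hypotheses (P0 : P 0) (P1 : ~ P 1).
Hypothesis PM : forall x y, ~ P x -> ~ P y -> ~ P (x * y).
Hypotheses (homP : homogeneous w P) (Pd0 : has_form w P d0).
Hypothesis symb_pow_deg : forall j d, has_form w (symb_pow P j) d -> (j <= d)%N.

Let a j := alpha w (symb_pow P j).

(** The [j]-th power of a form of least degree in [P] works. So [a j] is never the default value of
    [alpha]. *)
Let has_form_symb j : has_form w (symb_pow P j) (j * alpha w P)%N.
Proof.
have [f [Pf f0 fd]] := has_form_alpha Pd0.
exists (f ^+ j); split; last by rewrite mulnC; exact: dhomogMn.
  by apply: (ideal_pow_symb P0 P1 PM); exact: ideal_powX.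
exact: expf_neq0.
Qed.

Let a_form j : has_form w (symb_pow P j) (a j).
Proof. exact: has_form_alpha (has_form_symb j). Qed.

Lemma cvg_waldschmidt :
  cvg ((fun j => (alpha w (symb_pow P j))%:R / j%:R : R) @ \oo).
Proof.
apply: (@subadditive_cvg _ a) => i j; apply: alpha_le.
by apply: has_formM (a_form i) (a_form j); exact: symb_powM.
Qed.

Lemma waldschmidt_ge1 : 1 <= waldschmidt w R P.
Proof.
apply: limr_ge; first exact: cvg_waldschmidt.
near=> j; have j0 : (0 < j)%N by near: j; exact: nbhs_infty_ge.
by rewrite ler_pdivlMr ?ltr0n // mul1r ler_nat symb_pow_deg.
Unshelve. all: by end_near.
Qed.

Lemma waldschmidt_le_alpha : waldschmidt w R P <= (alpha w P)%:R.
Proof.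
apply: limr_le; first exact: cvg_waldschmidt.
near=> j; have j0 : (0 < j)%N by near: j; exact: nbhs_infty_ge.
by rewrite ler_pdivrMr ?ltr0n // -natrM ler_nat mulnC alpha_le.
Unshelve. all: by end_near.
Qed.

Lemma alpha_gt0 : (0 < alpha w P)%N.
Proof.
by rewrite -(ltr0n R) (lt_le_trans _ waldschmidt_le_alpha)//
   (lt_le_trans _ waldschmidt_ge1).
Qed.

Lemma resurgence_ge j : (0 < j)%N ->
  (((alpha w P)%:R / ((a j)%:R / j%:R + (alpha w P)%:R / j%:R) : R)%:E
    <= resurgence R P)%E.
Proof.
(* The least [r] with [a j < r * alpha w P]: degrees then forbid the [j]-th symbolic power to lie in
   the [r]-th power. *)
move=> j0; have al0 := alpha_gt0; pose r := (a j %/ alpha w P).+1.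
apply: (@le_trans _ _ (j%:R / r%:R)%:E); last first.
  apply: ereal_sup_ubound; exists j, r; split=> // jr.
  have : (r * alpha w P <= a j)%N.
    apply: alpha_ideal_pow => //; have [f [jf f0 fd]] := a_form j.
    by exists f; split=> //; exact: jr.
  by rewrite leqNgt ltn_ceil.
(* Clearing denominators leaves [r * alpha w P <= a j + alpha w P], true because [r - 1] is a
   quotient rounded down. *)
rewrite lee_fin -mulrDl invfM invrK mulrA mulrAC ler_pdivrMr; last first.
  by rewrite -natrD ltr0n addn_gt0 al0 orbT.
rewrite mulrAC ler_pdivlMr ?ltr0n // -natrD -!natrM ler_nat.
rewrite [X in (X <= _)%N]mulnAC [X in (X <= _)%N]mulnC leq_mul2l.
by rewrite mulnC mulSn addnC leq_add2r leq_trunc_div orbT.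
Qed.

Lemma waldschmidt_resurgence :
  (1%:E <= ((alpha w P)%:R / waldschmidt w R P)%:E <= resurgence R P)%E.
Proof.
have g0 : 0 < waldschmidt w R P by rewrite (lt_le_trans _ waldschmidt_ge1).
rewrite lee_fin ler_pdivlMr // mul1r waldschmidt_le_alpha /=.
pose x j : R := (alpha w P)%:R / ((a j)%:R / j%:R + (alpha w P)%:R / j%:R).
(* The shift avoids index 0, which [resurgence_ge] excludes. *)
have x_cvg : (fun j => x j.+1) @ \oo --> (alpha w P)%:R / waldschmidt w R P.
  apply: cvgM; [exact: cvg_cst|apply: cvgV]; first by rewrite gt_eqF.
  rewrite -[X in _ --> X]addr0 -(mulr0 (alpha w P)%:R); apply: cvgD.
    have := cvg_waldschmidt.
    by rewrite -(@cvg_shiftS _ (fun j => (a j)%:R / j%:R : R)); apply.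
  by apply: cvgM; [exact: cvg_cst|exact: cvg_harmonic].
have := fun j => resurgence_ge (ltn0Sn j).
(* The resurgence may be plus infinity; a single real lower bound rules out minus infinity. *)
case: (resurgence R P) => [s||] x_le.
- rewrite lee_fin -(cvg_lim _ x_cvg) //; apply: limr_le.
    by apply/cvg_ex; eexists; exact: x_cvg.
  by apply: nearW => j; have := x_le j; rewrite lee_fin.
- exact: leey.
- by have := x_le 0%N; rewrite leeNy_eq.
Qed.

End Waldschmidt.

(** * Order of vanishing along the monomial curve *)

Section Curve.
Variables (k : fieldType) (m : nat).
Local Notation T := {mpoly k[3]}.
Local Notation P := (curve_ideal k m).

(* The generic point of the curve moved in a generic direction:
   [x_i] goes to [t ^ wt i + z * x_i], with [t] the inner polynomial variable
   and [z] the outer one. *)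
Let move_pt (i : 'I_3) : {poly {poly T}} :=
  ('X^(wt m i))%:P + 'X * ('X_i)%:P%:P.

Let Phi : T -> {poly {poly T}} :=
  mmap (polyC \o polyC \o @mpolyC 3 k) move_pt.

(** At [z = 0] the moving point is back on the curve, so [f] lies in [P] exactly when [z] divides
    [Phi f]. *)
Lemma Phi_at0 f : (Phi f).[0] = map_poly (@mpolyC 3 k) (curve_map k m f).
Proof.
rewrite /Phi /curve_map /mmap -[_.[0]]/(horner_eval 0 _) !rmorph_sum /=.
apply: eq_bigr => j _; rewrite !rmorphM /= map_polyC /horner_eval hornerC.
congr (_ * _); rewrite -[_.[0]]/(horner_eval 0 _) /mmap1 !rmorph_prod.
apply: eq_bigr => i _.
rewrite !rmorphXn /= map_polyX.
by rewrite /horner_eval !hornerE.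
Qed.

(** At [z = 1] and [t = 0] the moving point is the point of coordinates [x_i], the weights being
    positive. *)
Lemma Phi_inj f : (Phi f).[1].[0] = f.
Proof.
rewrite /Phi /mmap -[_.[1]]/(horner_eval 1 _) -[_.[0]]/(horner_eval 0 _).
rewrite !rmorph_sum [RHS]mpolyE /=.
apply: eq_bigr => j _; rewrite !rmorphM /= /horner_eval !hornerC mul_mpolyC.
congr (_ *: _); rewrite -[_.[1]]/(horner_eval 1 _) -[_.[0]]/(horner_eval 0 _).
rewrite /mmap1 !rmorph_prod -[RHS]mmap1_id.
apply: eq_bigr => i _; rewrite !rmorphXn /= /horner_eval !hornerE.
by rewrite expr0n /wt addSn add0r.
Qed.

(** Each variable contributes degree at most 1 in [z], and its weight is at least 1. *)
Lemma size_Phi f d :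
  f \is d.-homog for (wdeg (wt m)) -> (size (Phi f) <= d.+1)%N.
Proof.
move=> /dhomogP fd; rewrite /Phi /mmap big_seq.
apply: (big_ind (fun p : {poly {poly T}} => (size p <= d.+1)%N)).
- by rewrite size_poly0.
- by move=> p q pd qd; rewrite (leq_trans (size_polyD _ _)) // geq_max pd.
move=> j /fd <-; rewrite mul_polyC (leq_trans (size_scale_leq _ _)) //.
rewrite /mmap1 /wdeg;
apply: (big_ind2 (fun (p : {poly {poly T}}) e => (size p <= e.+1)%N)).
- by rewrite size_poly1.
- move=> p a q b pa qb; rewrite (leq_trans (size_polyMleq _ _)) //.
  by rewrite -subn1 leq_subLR (leq_trans (leq_add pa qb)) // addSn addnS.
move=> i _; rewrite (leq_trans (size_poly_exp_leq _ _)) // ltnS mulnC.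
rewrite leq_mul2l; apply/orP; right; apply: leq_trans (_ : 1 <= _)%N => //.
rewrite /move_pt addrC mulrC size_MXaddC; case: ifP => // _.
by rewrite -subn1 leq_subLR ltnS size_polyC leq_b1.
Qed.

Lemma curve_map_neq0 s : ~ P s -> (Phi s).[0] != 0.
Proof.
move=> Ps; rewrite Phi_at0; apply/eqP => s0; apply: Ps; rewrite /curve_ideal /=.
apply: (@map_inj_poly _ _ (@mpolyC 3 k)); last by rewrite s0 rmorph0.
  exact: (can_inj (@mpolyCK 3 k)).
exact: mpolyC0.
Qed.

Let ord_ge n : set T := [set f | exists g, Phi f = g * 'X^n].

Lemma ideal_pow_ord n : ideal_pow P n `<=` ord_ge n.
Proof.
have PhiM : {morph Phi : x y / x * y} := rmorphM _.
apply: ideal_pow_ind => {n}.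
- by move=> n; exists 0; rewrite mul0r [LHS]rmorph0.
- move=> n x y [g xE] [h yE]; exists (g + h).
  by rewrite [LHS]rmorphD mulrDl -xE -yE.
- move=> n1 n2 x y [g xE] [h yE]; exists (g * h).
  by rewrite PhiM exprD mulrACA -xE -yE.
- by move=> a; exists (Phi a); rewrite mulr1.
(* An element of [P] vanishes at [z = 0], hence is divisible by [z] after [Phi]. *)
- move=> x Px; have /factor_theorem[g xE] : root (Phi x) 0.
    by rewrite /root Phi_at0 Px rmorph0.
  by exists g; rewrite xE subr0.
Qed.

Lemma curve_ideal0 : P 0.
Proof. exact: rmorph0. Qed.

Lemma curve_idealN1 : ~ P 1.
Proof. by apply/eqP; rewrite /curve_map rmorph1 oner_eq0. Qed.

Lemma curve_ideal_prime f g : ~ P f -> ~ P g -> ~ P (f * g).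
Proof.
move=> /eqP f0 /eqP g0; apply/eqP.
by rewrite /curve_map rmorphM mulf_neq0.
Qed.

(* [Phi] sends elements of [P ^ n] to multiples of [z ^ n], and elements outside
   [P] to polynomials prime to [z]; so [z ^ n] divides [Phi f], whose degree in
   [z] is at most the ordinary degree of [f]. *)
Lemma symb_pow_curve_deg n d : has_form (wt m) (symb_pow P n) d -> (n <= d)%N.
Proof.
move=> [f [fn f0 fd]].
have [s Ps sf] :=
  (symb_powP curve_ideal0 curve_idealN1 curve_ideal_prime n f).1 fn.
have Phif0 : Phi f != 0.
  by apply: contraNneq f0 => Phif; rewrite -[f]Phi_inj Phif !horner0.
have [e [g g0 fE]] := multiplicity_XsubC (Phi f) 0.
rewrite Phif0 subr0 /= in g0 fE.
have [h hE] := ideal_pow_ord sf.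
have ne : (n <= e)%N.
  (* If [e < n], cancelling [z ^ e] and setting [z = 0] makes a product of two nonzero values equal
     to 0. *)
  rewrite leqNgt; apply/negP => en.
  have : Phi s * g = h * 'X^(n - e).
    apply: (mulIf (monic_neq0 (monicXn _ e))).
    by rewrite -mulrA -fE -mulrA -exprD subnK 1?ltnW // -hE [RHS]rmorphM.
  move/(congr1 (fun p => p.[0])); rewrite !hornerM hornerXn expr0n subn_eq0.
  rewrite leqNgt en mulr0 => /eqP; rewrite mulf_eq0 (negPf (curve_map_neq0 Ps)).
  exact/negP.
rewrite -ltnS; apply: leq_trans (size_Phi fd).
have g_neq0 : g != 0 by apply: contraNneq g0 => ->; exact: root0.
rewrite fE size_Mmonic ?monicXn // size_polyXn addnS /=.
rewrite (leq_ltn_trans ne) // -[X in (X < _)%N]add0n.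
by rewrite ltn_add2r size_poly_gt0.
Qed.

Lemma curve_mapX (j : 'X_{1..3}) : curve_map k m 'X_[j] = 'X^(wdeg (wt m) j).
Proof.
rewrite /curve_map mmapX /mmap1 /wdeg.
rewrite (big_morph (fun e => 'X^e) (exprD _) (expr0 _)).
by apply: eq_bigr => i _; rewrite -exprM mulnC.
Qed.

Lemma curve_mapE f :
  curve_map k m f = \sum_(j <- msupp f) f@_j *: 'X^(wdeg (wt m) j).
Proof.
apply: eq_bigr => j _.
by rewrite mul_polyC -curve_mapX [in RHS]/curve_map mmapX.
Qed.

(** Monomials of weight [d] all go to [t ^ d], so the component of degree [d] of [f] maps to the
    term of degree [d] of [curve_map k m f]. *)
Lemma curve_homogeneous : homogeneous (wt m) P.
Proof.
move=> f j Pf jf; set d := wdeg _ j.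
exists (pihomog (wdeg (wt m)) d f); split; last exact: pihomogP.
- have := congr1 (fun p : {poly k} => p`_d *: 'X^d) Pf.
  rewrite curve_mapE coef0 scale0r coef_sum scaler_suml => E.
  rewrite /curve_ideal /= /curve_map raddf_sum /= -[RHS]E big_mkcond.
  apply: eq_bigr => i _; rewrite coefZ coefXn eq_sym.
  case: eqP => [di|_]; last by rewrite mulr0 scale0r.
  by rewrite mmapZ mul_polyC mulr1 [X in _ *: X]curve_mapX -di.
- apply: contraTneq jf => /(congr1 (mcoeff j)).
  rewrite mcoeff0 raddf_sum big_mkcond mcoeff_msupp /=.
  have [_ //|f_j] := eqVneq f@_j 0.
  rewrite (bigD1_seq j) ?msupp_uniq ?mcoeff_msupp //= eqxx big1 => [|i ij].
    by rewrite addr0 mcoeffZ mcoeffX eqxx mulr1 => /eqP; rewrite (negPf f_j).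
  by case: ifP; rewrite // mcoeffZ mcoeffX (negPf ij) mulr0.
Qed.

(** The form is [x_1 x_3 - x_2 ^ 2], because [3 + (3 + 2m) = 2 (3 + m)]. *)
Lemma has_form_curve : has_form (wt m) P (6 + 2 * m).
Proof.
pose x0 : 'I_3 := Ordinal (isT : 0 < 3)%N.
pose x1 : 'I_3 := Ordinal (isT : 1 < 3)%N.
pose x2 : 'I_3 := Ordinal (isT : 2 < 3)%N.
have deg02 : wdeg (wt m) (U_(x0) + U_(x2)) = (6 + 2 * m)%N.
  rewrite /wdeg !big_ord_recl big_ord0 !mnmE /wt /=.
  by rewrite !(mul0n, mul1n, addn0, add0n) addnA.
have deg11 : wdeg (wt m) (U_(x1) *+ 2) = (6 + 2 * m)%N.
  rewrite /wdeg !big_ord_recl big_ord0 !mnmE /wt /=.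
  by rewrite !(mul0n, mul1n, addn0, add0n) mulnDr.
exists ('X_[U_(x0) + U_(x2)] - 'X_[U_(x1) *+ 2]); split.
- rewrite /curve_ideal /= [LHS]mmapB -!/(curve_map k m _).
  by rewrite !curve_mapX deg02 deg11 subrr.
- apply/eqP => /(congr1 (mcoeff (U_(x0) + U_(x2)))).
  rewrite mcoeffB mcoeff0 !mcoeffX eqxx.
  (* The exponents of the middle variable are 2 and 0. *)
  have -> : ((U_(x1) *+ 2)%MM == (U_(x0) + U_(x2))%MM) = false.
    by apply/eqP => /mnmP/(_ x1); rewrite !mnmE.
  by rewrite subr0 => /eqP; rewrite oner_eq0.
- by apply: rpredB; rewrite dhomogX; apply/eqP; [exact: deg02|exact: deg11].
Qed.

End Curve.

Theorem theorem7p9 (k : fieldType) (R : realType) (m : nat)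
    (hm : (1 <= m)%N) (hcop : coprime 3 m) :
  let p := curve_ideal k m in
  let q : R := (alpha (wt m) p)%:R / waldschmidt (wt m) R p in
  (1%:E <= q%:E <= resurgence R p)%E.
Proof.
apply: waldschmidt_resurgence.
- exact: curve_ideal0.
- exact: curve_idealN1.
- exact: curve_ideal_prime.
- exact: curve_homogeneous.
- exact: has_form_curve.
- exact: symb_pow_curve_deg.
Qed.
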